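(* Consider an Arctic Auction instance with integral budgets and utilities satisfying the perturbation assumption. Let $(p,x,r)$ be the state at the beginning of a $\Delta$-scaling phase of the scaling algorithm, and let $(p^*,x^*,r^* )$ be the limiting equilibrium reached by the scaling algorithm. If $$\Delta<\frac{1}{8nD}\qquad\text{and}\qquad E_\Delta:=\{(i,j)\in B\times G:x_{ij}>4n\Delta\},$$ then $E_\Delta=H^*$, where $H^*=\{(i,j)\in B\times G:x^*_{ij}>0\}$ is the support of the equilibrium. Consequently, $$\operatorname{BasicSolution}(E_\Delta)=(p^*,x^*,r^* ).$$
   Context: **Arctic Auction.** $B$ (buyers) and $G$ (divisible goods, one unit of each) are finite sets, $n=|B|+|G|$. Buyer $i$ has budget $e_i>0$ and utility $U_{ij}\ge 0$ per unit of good $j$; every buyer values some good positively and every good is valued positively by some buyer. $U_{\max}=\max\{U_{ij}:U_{ij}>0\}$, $D=n(U_{\max})^n$. For a positive price vector $p$: $\alpha_i(p)=\max_{j\in G}U_{ij}/p_j$ and $E(p)=\{(i,j): U_{ij}/p_j=\alpha_i(p)\}$ (equality graph). A state $(p,x,r)$ consists of prices, spendings $x_{ij}\ge 0$ and refunds $r_i\ge 0$; $\bar c_i(x)=e_i-r_i-\sum_{j}x_{ij}$, $b_j(p,x)=-p_j+\sum_i x_{ij}$. **Arctic equilibrium**: a state with (1) $\bar c_i(x)=0$ for all $i$; (2) $b_j(p,x)=0$ for all $j$; (3) $x_{ij}>0\Rightarrow(i,j)\in E(p)$; (4) $r_i>0\Rightarrow\alpha_i(p)\le1$, $\alpha_i(p)>1\Rightarrow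 r_i=0$, and $\alpha_i(p)<1\Rightarrow x_{ij}=0$ for all $j$. **Perturbation assumption.** For every price vector $p$, $E(p)$ is cycle-free, and each connected component of $E(p)$ contains at most one buyer $i$ with $\alpha_i(p)=1$. **Basic solution.** For a cycle-free $H\subseteq B\times G$, a triple $(p,x,r)$ is the basic solution of $H$, written $\operatorname{BasicSolution}(H)$, if: (1) $U_{ij}/p_j=U_{ik}/p_k$ whenever $(i,j),(i,k)\in H$; (2) for each connected component $C$ of $H$ (on node set $B\cup G$) exactly one of: (a) $\sum_{i\in C\cap B}e_i=\sum_{j\in C\cap G}p_j$; (b) there is a unique buyer $i_C\in C\cap B$ with $U_{i_Cj}/p_j=1$ for every $(i_C,j)\in H$; (3) $x_{ij}=0$ for $(i,j)\notin H$; (4) $r_i=e_i-\sum_jx_{ij}$ for all $i$; (5) $r_i=0$ if $i$ is not an anchor buyer $i_C$ from (2)(b); (6) $\sum_i x_{ij}=p_j$ for all $j$. **Scaling algorithm.** Initial data: $\Delta_0=\max_i e_i$, $p^0_j=\max_{i}\frac{U_{ij}e_i}{n\sum_{k}U_{ik}}$, $x^0=0$, $r^0=0$. A state is *$\Delta$-feasible* if (1) $r_i\ge0$, $\bar c_i(x)\ge0$ for all $i$; (2) if $p_j>p_j^0$ then $0\le b_j(p,x)\le\Delta$; (3) if $x_{ij}>0$ then $(i,j)\in E(p)$ and $x_{ij}$ is a multiple of $\Delta$; (4) $x,p\ge0$. It is *$\Delta$-optimal* if moreover $\bar c_i(x)<\Delta$ for all $i$. The *residual network* $N(p,x,r)$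 on $B\cup G$ has a forward arc $(i,j)$ for each $(i,j)\in E(p)$ and a backward arc $(j,i)$ whenever $x_{ij}>0$. *Price-and-augment step:* choose a buyer $\rho$ with $\bar c_\rho(x)\ge\Delta$, $\alpha_\rho(p)>1$; let $A$ be the set of nodes reachable from $\rho$ in $N(p,x,r)$. While no good $j\in A$ has $b_j(p,x)\le0$ and no buyer $i\in A$ has $\alpha_i(p)=1$: multiply $p_j$, $j\in A\cap G$, by the maximum $q\ge1$ such that the state remains $\Delta$-feasible and at least one of the following occurs: a new equality edge appears; some $j\in A\cap G$ has $b_j\le0$; some $i\in A\cap B$ has $\alpha_i=1$; then recompute $A$. Afterwards, if some buyer $i\in A$ has $\alpha_i(p)=1$, take a directed path in $N(p,x,r)$ from $\rho$ to $i$, increase $x$ by $\Delta$ on its forward arcs, decrease $x$ by $\Delta$ on its backward arcs, and set $r_i\leftarrow r_i+\Delta$; otherwise do the same augmentation along a path from $\rho$ to a good $j\in A$ with $b_j(p,x)\le0$ (no refund change). Starting from $(p^0,x^0,r^0)$ and $\Delta=\Delta_0$, repeat *$\Delta$-scaling phases*: while the state is not $\Delta$-optimal, if some buyer $i$ has $\alpha_i(p)\le1$ and $\bar c_i(x)\ge\Delta$ set $r_i\leftarrow r_i+\Delta$, else apply the price-and-augment step. Between phases do *halving-and-repair*: with $\Delta'=\Delta/2$, for each good $j$ with $b_j(p,x)>\Delta'$ choose a buyer $i(j)$ with $x_{i(j)j}>0$ and decrease $x_{i(j)j}$ by $\Delta'$; set $\Delta\leftarrow\Delta/2$. (The actual algorithm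 stops as soon as $\Delta<1/(8nD)$; the *limiting equilibrium* $(p^*,x^*,r^* )$ is the limit of the states when phases are continued indefinitely.)
   Formalization: The limit of the states is assumed to be an Arctic equilibrium (it fails for one buyer, one good, e=100, U=1), and ''exactly one of (a),(b)'' means one designated normalization per component, since both hold at the equilibrium for e=U=1. *)

(* Defs.v *)
From HB Require Import structures.
From mathcomp Require Import all_boot all_order all_algebra.
From mathcomp Require Import classical_sets reals topology normedtype sequences.
Set Implicit Arguments.
Unset Strict Implicit.
Unset Printing Implicit Defensive.
Import Order.TTheory GRing.Theory Num.Theory.
Import numFieldNormedType.Exports.
Local Open Scope ring_scope.

Record auction (R : realType) (B G : finType) := Auction {
  budget : B -> R;
  util : B -> G -> R;
  budget_gt0 : forall i, 0 < budget i;
  util_ge0 : forall i j, 0 <= util i j;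
  buyer_values_some : forall i, exists j, 0 < util i j;
  good_valued_by_some : forall j, exists i, 0 < util i j }.

Record state (R : realType) (B G : finType) := State {
  price : G -> R;
  spend : B -> G -> R;
  refund : B -> R }.

Section Auction.
Variables (R : realType) (B G : finType) (M : auction R B G).
Local Notation e := (budget M).
Local Notation U := (util M).
Local Notation node := (B + G)%type.
Local Notation st := (state R B G).
Implicit Types (p : G -> R) (s : st) (H : {set B * G}) (Delta : R).

Definition integral_data : Prop :=
  (forall i, e i \is a Num.int) /\ (forall i j, U i j \is a Num.int).

Definition nn : nat := (#|B| + #|G|)%N.

(* The maxima below are over families of nonnegative numbers, so that the
   default value 0 never changes them. *)
Definition Umax : R :=
  \big[Num.max/0]_(ij : B * G | 0 < U ij.1 ij.2) U ij.1 ij.2.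

Definition DD : R := nn%:R * Umax ^+ nn.

Definition alpha p i : R := \big[Num.max/0]_(j : G) (U i j / p j).

Definition equality_graph p : {set B * G} :=
  [set ij | U ij.1 ij.2 / p ij.2 == alpha p ij.1].

Definition surplus s i : R := e i - refund s i - \sum_j spend s i j.

Definition excess s j : R := - price s j + \sum_i spend s i j.

Definition arctic_equilibrium s : Prop :=
  [/\ (forall j, 0 < price s j),
      (forall i j, 0 <= spend s i j) & (forall i, 0 <= refund s i)] /\
  [/\ (forall i, surplus s i = 0),
      (forall j, excess s j = 0),
      (forall i j, 0 < spend s i j -> (i, j) \in equality_graph (price s)) &
      (forall i, [/\ (0 < refund s i -> alpha (price s) i <= 1),
                     (1 < alpha (price s) i -> refund s i = 0) &
                     (alpha (price s) i < 1 -> forall j, spend s i j = 0)])].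

(** Bipartite graphs on B + G *)

Definition adj H : rel node := fun u v =>
  match u, v with
  | inl i, inr j => (i, j) \in H
  | inr j, inl i => (i, j) \in H
  | _, _ => false
  end.

Definition component H (v : node) : {set node} :=
  [set w | connect (adj H) v w].

(* The closed walk u - v - u is a [ucycle] of size 2, but not a graph cycle. *)
Definition cycle_free H : Prop :=
  forall c : seq node, ucycle (adj H) c -> (size c <= 2)%N.

Definition perturbed : Prop :=
  forall p, (forall j, 0 < p j) ->
    cycle_free (equality_graph p) /\
    (forall i i', inl i' \in component (equality_graph p) (inl i) ->
       alpha p i = 1 -> alpha p i' = 1 -> i = i').

(** Basic solutions *)

Definition unit_rate H p i : Prop :=
  forall j, (i, j) \in H -> U i j / p j = 1.

(* "Exactly one of (a), (b)" says which one of the two normalizing equations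
   is imposed on a component: [anchors] is the set of the buyers i_C of the
   components normalized by (b); on a component without anchor, (a) is imposed.
   It cannot say that the other equation fails: for one buyer and one good with
   e = U = 1, the equilibrium p = x = 1, r = 0 satisfies both. *)
Definition basic_solution H s : Prop :=
  cycle_free H /\ (forall j, 0 < price s j) /\
  exists anchors : {set B},
  [/\ (forall i j k, (i, j) \in H -> (i, k) \in H ->
         U i j / price s j = U i k / price s k),
      (forall v, let C := component H v in
         ((forall i, inl i \in C -> i \notin anchors) /\
          \sum_(i | inl i \in C) e i = \sum_(j | inr j \in C) price s j)
         \/
         (exists i, [/\ inl i \in C,
                        (forall i', inl i' \in C -> (i' \in anchors) = (i' == i)),
                        unit_rate H (price s) i &
                        forall i', inl i' \in C ->
                          unit_rate H (price s) i' -> i' = i])),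
      (forall i j, (i, j) \notin H -> spend s i j = 0) &
      [/\ (forall i, refund s i = e i - \sum_j spend s i j),
          (forall i, i \notin anchors -> refund s i = 0) &
          (forall j, \sum_i spend s i j = price s j)]].

(** The scaling algorithm *)

Definition Delta0 : R := \big[Num.max/0]_(i : B) e i.

Definition price0 j : R :=
  \big[Num.max/0]_(i : B) (U i j * e i / (nn%:R * \sum_k U i k)).

Definition init_state : st := State price0 (fun _ _ => 0) (fun _ => 0).

Definition feasible Delta s : Prop :=
  [/\ (forall i, 0 <= refund s i /\ 0 <= surplus s i),
      (forall j, price0 j < price s j -> 0 <= excess s j <= Delta),
      (forall i j, 0 < spend s i j ->
         (i, j) \in equality_graph (price s) /\
         exists m : nat, spend s i j = m%:R * Delta) &
      (forall i j, 0 <= spend s i j) /\ (forall j, 0 <= price s j)].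

Definition optimal Delta s : Prop :=
  feasible Delta s /\ forall i, surplus s i < Delta.

Definition residual s : rel node := fun u v =>
  match u, v with
  | inl i, inr j => (i, j) \in equality_graph (price s)
  | inr j, inl i => 0 < spend s i j
  | _, _ => false
  end.

Definition reach s (rho : B) : {set node} :=
  [set v | connect (residual s) (inl rho) v].

(* The good (resp. buyer) condition in the guard of the price loop, on a set of
   nodes A. *)
Definition good_target s (A : {set node}) : Prop :=
  exists j, inr j \in A /\ excess s j <= 0.

Definition buyer_target s (A : {set node}) : Prop :=
  exists i, inl i \in A /\ alpha (price s) i = 1.

Definition raise s (A : {set node}) (q : R) : st :=
  State (fun j => if inr j \in A then q * price s j else price s j)
        (spend s) (refund s).

Definition price_event s (A : {set node}) (q : R) : Prop :=
  let s' := raise s A q in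
  [\/ exists ij, ij \in equality_graph (price s') /\
                 ij \notin equality_graph (price s),
      good_target s' A | buyer_target s' A].

(* "The maximum q such that an event occurs" means either that the prices are
   raised as long as no event has occurred, or that q is maximal among all the
   multipliers at which some event occurs (so that earlier events may be
   passed).  Both choices of q are allowed; runs using only one of them are
   particular cases. *)
Definition price_multiplier Delta s (A : {set node}) (q : R) : Prop :=
  [/\ 1 <= q, feasible Delta (raise s A q), price_event s A q &
      (forall q', 1 <= q' -> q' < q -> ~ price_event s A q') \/
      (forall q', 1 <= q' -> feasible Delta (raise s A q') ->
         price_event s A q' -> q' <= q)].

Inductive price_loop Delta (rho : B) : st -> st -> Prop :=
| price_stop s : good_target s (reach s rho) \/ buyer_target s (reach s rho) ->
    price_loop Delta rho s s
| price_raise s q s' :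
    ~ good_target s (reach s rho) -> ~ buyer_target s (reach s rho) ->
    price_multiplier Delta s (reach s rho) q ->
    price_loop Delta rho (raise s (reach s rho) q) s' ->
    price_loop Delta rho s s'.

Definition residual_path s (rho : B) (v : node) (w : seq node) : Prop :=
  [/\ path (residual s) (inl rho) w, uniq (inl rho :: w) &
      last (inl rho) w = v].

Definition arcs (rho : B) (w : seq node) : seq (node * node) :=
  zip (inl rho :: w) w.

Definition augment_spend Delta s (rho : B) (w : seq node) (i : B) (j : G) : R :=
  spend s i j + (if (inl i, inr j) \in arcs rho w then Delta else 0)
              - (if (inr j, inl i) \in arcs rho w then Delta else 0).

Definition add_refund Delta s (i : B) : B -> R :=
  fun i' => if i' == i then refund s i' + Delta else refund s i'.

Inductive augment Delta s (rho : B) : st -> Prop :=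
| augment_to_buyer i w :
    inl i \in reach s rho -> alpha (price s) i = 1 ->
    residual_path s rho (inl i) w ->
    augment Delta s rho
      (State (price s) (augment_spend Delta s rho w) (add_refund Delta s i))
| augment_to_good j w :
    ~ buyer_target s (reach s rho) ->
    inr j \in reach s rho -> excess s j <= 0 ->
    residual_path s rho (inr j) w ->
    augment Delta s rho
      (State (price s) (augment_spend Delta s rho w) (refund s)).

Definition refundable Delta s i : Prop :=
  alpha (price s) i <= 1 /\ Delta <= surplus s i.

Inductive scaling_step Delta s : st -> Prop :=
| refund_step i : refundable Delta s i ->
    scaling_step Delta s (State (price s) (spend s) (add_refund Delta s i))
| price_and_augment_step rho s1 s2 :
    (forall i, ~ refundable Delta s i) ->
    Delta <= surplus s rho -> 1 < alpha (price s) rho ->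
    price_loop Delta rho s s1 -> augment Delta s1 rho s2 ->
    scaling_step Delta s s2.

Inductive scaling_phase Delta : st -> st -> Prop :=
| phase_end s : optimal Delta s -> scaling_phase Delta s s
| phase_continue s s1 s2 : ~ optimal Delta s -> scaling_step Delta s s1 ->
    scaling_phase Delta s1 s2 -> scaling_phase Delta s s2.

Definition repair_at Delta s (pick : G -> B) : st :=
  State (price s)
    (fun i j => if (Delta / 2 < excess s j) && (i == pick j)
                then spend s i j - Delta / 2 else spend s i j)
    (refund s).

Definition halving_and_repair Delta s s' : Prop :=
  exists pick : G -> B,
    (forall j, Delta / 2 < excess s j -> 0 < spend s (pick j) j) /\
    s' = repair_at Delta s pick.

Definition phase_Delta (k : nat) : R := Delta0 / 2 ^+ k.

(* [run k] is the state at the beginning of the [phase_Delta k]-scaling phase;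
   phases are continued indefinitely. *)
Definition scaling_run (run : nat -> st) : Prop :=
  run 0%N = init_state /\
  forall k, exists2 s, scaling_phase (phase_Delta k) (run k) s &
                       halving_and_repair (phase_Delta k) s (run k.+1).

(* The limit of the states is required to be an equilibrium, because it need not
   be one when the initial prices are too high: for one buyer and one good with
   e = 100 and U = 1, price0 = 50, the whole budget is refunded in the first
   phase, and the run is constant afterwards with the good unsold. *)
Definition limiting_equilibrium (run : nat -> st) (s : st) : Prop :=
  arctic_equilibrium s /\
  [/\ (forall j, ((fun k => price (run k) j) @ \oo --> price s j)%classic),
      (forall i j, ((fun k => spend (run k) i j) @ \oo --> spend s i j)%classic) &
      (forall i, ((fun k => refund (run k) i) @ \oo --> refund s i)%classic)].

Definition abundant_edges Delta s : {set B * G} :=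
  [set ij | 4 * nn%:R * Delta < spend s ij.1 ij.2].

Definition spend_support s : {set B * G} := [set ij | 0 < spend s ij.1 ij.2].

End Auction.

Arguments nn : clear implicits.

(* Main.v *)
(** Each step of a phase lowers the total surplus by [Delta] and moves every
    spending by at most [Delta], so a phase moves a spending by at most the drop
    of the total surplus, which is at most [(2 |B| + |G|) Delta] when the phase
    starts.  Summing over the later phases and repairs, the spendings at the start
    of the [Delta]-phase are within [4 n Delta] of their limits.  On the other
    hand, a positive equilibrium spending is at least [1 / D > 8 n Delta]: within
    a component of the support all prices are rational with a common denominator
    at most [D], and cutting the forest at an edge expresses the spending on it as
    a difference of budgets and prices.  Hence the threshold [4 n Delta] separates
    the support from its complement. *)

Require Import Defs.
From mathcomp Require Import all_boot all_order all_algebra.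
From mathcomp Require Import classical_sets reals topology normedtype sequences.
From mathcomp Require Import lra.
Set Implicit Arguments.
Unset Strict Implicit.
Unset Printing Implicit Defensive.
Import Order.TTheory GRing.Theory Num.Theory.
Import numFieldNormedType.Exports.
Local Open Scope ring_scope.

(** * Movement of the spendings along the algorithm *)

Section Convergence.
Variables (R : realType) (B G : finType) (M : auction R B G).
Implicit Types (s : state R B G) (Delta : R).
Local Notation node := (B + G)%type.

Definition total_surplus s : R := \sum_i surplus M s i.

(** A potential on the nodes: it rises by 1 along a forward arc and falls by 1 along a backward
    arc. *)
Definition good_side (v : node) : R := if v is inr _ then 1 else 0.

Lemma sum_indicator (a : B -> G -> node * node) (u : node * node) i0 j0 :
  (forall i j, (a i j == u) = (i == i0) && (j == j0)) ->
  \sum_i \sum_j ((a i j == u)%:R : R) = 1.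
Proof.
move=> au; rewrite (bigD1 i0) //= (bigD1 j0) //= au !eqxx big1 ?addr0.
  rewrite big1 ?addr0 // => i /negPf ni; rewrite big1 // => j _.
  by rewrite au ni.
by move=> j /negPf nj; rewrite au nj andbF.
Qed.

(** Telescoping: forward minus backward arcs is the change of the potential [good_side] along the
    path. *)
Lemma arcs_count s (u : node) (w : seq node) :
  path (residual M s) u w -> uniq (u :: w) ->
  \sum_i \sum_j (((inl i, inr j) \in zip (u :: w) w)%:R : R)
    - \sum_i \sum_j ((inr j, inl i) \in zip (u :: w) w)%:R
  = good_side (last u w) - good_side u.
Proof.
elim: w u => [|v w IH] u.
  by move=> _ _; rewrite /= !subrr.
move=> /= /andP[uv pw] /andP[nu uw].
(* Since [u] is not revisited, its outgoing arc does not recur, so membership in the arc list counts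
   it exactly once. *)
have zu x : (u, x) \notin zip (v :: w) w.
  apply: contra nu; elim: (w) (v) => [|y t IHt] z //=.
  rewrite !in_cons xpair_eqE => /orP[/andP[-> //]|/IHt].
  by rewrite in_cons => ->; rewrite orbT.
have split_mem (a : B -> G -> node * node) :
    \sum_i \sum_j ((a i j \in (u, v) :: zip (v :: w) w)%:R : R) =
    \sum_i \sum_j ((a i j == (u, v))%:R : R) +
    \sum_i \sum_j ((a i j \in zip (v :: w) w)%:R : R).
  rewrite -big_split; apply: eq_bigr => i _ /=.
  rewrite -big_split; apply: eq_bigr => j _ /=.
  rewrite inE -natrD; case: eqP => [->|_] //=.
  by rewrite (negPf (zu v)).
have {}IH := IH v pw uw.
rewrite !split_mem.
case: u v uv IH {pw nu uw zu split_mem} => [i|j] [i'|j'] //= _ IH.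
  rewrite (@sum_indicator (fun i j => (inl i, inr j)) _ i j'); last first.
    by move=> *; rewrite xpair_eqE.
  rewrite [X in _ - (X + _)]big1; last by move=> *; rewrite big1.
  by move: IH; lra.
rewrite (@sum_indicator (fun i j => (inr j, inl i)) _ i' j); last first.
  by move=> *; rewrite xpair_eqE andbC.
rewrite [X in X + _ - _]big1; last by move=> *; rewrite big1.
by move: IH; lra.
Qed.

Lemma sum_augment_spend Delta s rho w :
  path (residual M s) (inl rho) w -> uniq (inl rho :: w : seq node) ->
  \sum_i \sum_j augment_spend Delta s rho w i j =
  \sum_i \sum_j spend s i j + Delta * good_side (last (inl rho) w).
Proof.
move=> pw uw.
have := arcs_count pw uw; rewrite /= subr0 => <-.
rewrite mulrBr !mulr_sumr addrA -big_split -sumrB; apply: eq_bigr => i _ /=.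
rewrite !mulr_sumr -big_split -sumrB; apply: eq_bigr => j _ /=.
rewrite /augment_spend /arcs; do 2![case: (_ \in _)]; rewrite /= ?mulr1 ?mulr0 //.
Qed.

Lemma total_surplusE s :
  total_surplus s =
  \sum_i budget M i - \sum_i refund s i - \sum_i \sum_j spend s i j.
Proof. by rewrite /total_surplus /surplus !sumrB. Qed.

Lemma sum_add_refund Delta s i :
  \sum_i' add_refund Delta s i i' = \sum_i' refund s i' + Delta.
Proof.
rewrite (bigD1 i) //= [in RHS](bigD1 i) //= /add_refund eqxx addrAC.
congr (_ + _ + _); apply: eq_bigr => i' /negPf -> //.
Qed.

Lemma augment_spend_dist Delta s rho w i j : 0 <= Delta ->
  `|augment_spend Delta s rho w i j - spend s i j| <= Delta.
Proof.
move=> D0; rewrite /augment_spend ler_norml.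
by do 2![case: (_ \in _)]; lra.
Qed.

Lemma price_loop_inv Delta rho s s' : price_loop M Delta rho s s' ->
  spend s' = spend s /\ refund s' = refund s.
Proof. by elim. Qed.

(** A path to a buyer keeps the total spending and adds [Delta] to the refunds; a path to a good
    adds [Delta] to the total spending. Either way the total surplus pays [Delta]. *)
Lemma augment_change Delta s rho s' : 0 <= Delta -> augment M Delta s rho s' ->
  total_surplus s' = total_surplus s - Delta /\
  forall i j, `|spend s' i j - spend s i j| <= Delta.
Proof.
move=> D0 [i w _ _ [pw uw lw]|j w _ _ _ [pw uw lw]];
  (split; last by move=> *; exact: augment_spend_dist).
all: rewrite !total_surplusE /= (sum_augment_spend Delta pw uw) lw /=.
  by rewrite sum_add_refund; lra.
by lra.
Qed.

Lemma scaling_step_change Delta s s' : 0 <= Delta -> scaling_step M Delta s s' ->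
  total_surplus s' = total_surplus s - Delta /\
  forall i j, `|spend s' i j - spend s i j| <= Delta.
Proof.
move=> D0 [i _|rho s1 s2 _ _ _ /price_loop_inv[xE rE] /(augment_change D0)[TE dx]].
  split=> [|i' j']; last by rewrite subrr normr0.
  by rewrite !total_surplusE /= sum_add_refund; lra.
split=> [|i j]; last by rewrite -xE.
by rewrite TE !total_surplusE xE rE.
Qed.

(** The total surplus acts as a step counter, so the number of steps never has to be bounded. *)
Lemma scaling_phase_change Delta s s' : 0 <= Delta -> scaling_phase M Delta s s' ->
  forall i j, `|spend s' i j - spend s i j| <= total_surplus s - total_surplus s'.
Proof.
move=> D0; elim=> {s s'} [s _ i j|s s1 s2 _ st _ IH i j]; first by rewrite !subrr normr0.
have [TE /(_ i j)] := scaling_step_change D0 st.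
move: (IH i j); rewrite TE => h1 h2.
rewrite -[X in X - _](subrK (spend s1 i j)) -addrA.
by apply: le_trans (ler_normD _ _) _; lra.
Qed.

Lemma scaling_phase_optimal Delta s s' :
  scaling_phase M Delta s s' -> optimal M Delta s'.
Proof. by elim. Qed.

Lemma optimal_total_surplus Delta s : optimal M Delta s ->
  0 <= total_surplus s <= #|B|%:R * Delta.
Proof.
move=> [[pos _ _ _] lt]; rewrite sumr_ge0 => [|i _]; last by case: (pos i).
by rewrite mulr_natl -sumr_const ler_sum // => i _; exact/ltW.
Qed.

(** Each good loses [Delta / 2] from at most one buyer, [pick j]. *)
Lemma repair_at_change Delta s pick : 0 <= Delta ->
  total_surplus (repair_at Delta s pick) <= total_surplus s + #|G|%:R * (Delta / 2) /\
  forall i j, `|spend (repair_at Delta s pick) i j - spend s i j| <= Delta / 2.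
Proof.
move=> D0; split=> [|i j]; last first.
  by rewrite /=; case: ifP => _; rewrite ler_norml; lra.
rewrite !total_surplusE.
suff : \sum_i \sum_j spend s i j - #|G|%:R * (Delta / 2) <=
       \sum_i \sum_j spend (repair_at Delta s pick) i j by rewrite /=; lra.
rewrite exchange_big [leRHS]exchange_big /= mulr_natl -sumr_const -sumrB.
apply: ler_sum => j _.
rewrite (bigD1 (pick j)) //= [leRHS](bigD1 (pick j)) //= eqxx andbT.
rewrite [X in _ <= _ + X](eq_bigr (fun i => spend s i j)) => [|i /negPf ->];
  last by rewrite andbF.
by case: ifP => _; lra.
Qed.

Lemma phase_DeltaS k : phase_Delta M k.+1 = phase_Delta M k / 2.
Proof. by rewrite /phase_Delta exprSr invfM mulrA. Qed.

Lemma Delta0_ge0 : 0 <= Delta0 M.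
Proof.
rewrite /Delta0; elim/big_ind: _ => // [x y x0 y0|i _]; last exact/ltW/budget_gt0.
by rewrite le_max x0.
Qed.

Lemma phase_Delta_ge0 k : 0 <= phase_Delta M k.
Proof. by rewrite divr_ge0 ?Delta0_ge0 ?exprn_ge0. Qed.

Variables (run : nat -> state R B G) (run_alg : scaling_run M run).

(** With [Delta] the new scale, the previous phase leaves at most [#|B| * (2 * Delta)] and the
    repair adds at most [#|G| * Delta]. In the first phase the surpluses are the budgets, at most
    [Delta0] each. *)
Lemma run_total_surplus k :
  total_surplus (run k) <= (2 * #|B|%:R + #|G|%:R) * phase_Delta M k.
Proof.
case: run_alg => r0 rS; case: k => [|k].
  rewrite r0 total_surplusE /= [X in _ - X - _]big1 //.
  rewrite [X in _ - _ - X]big1 => [|i _]; last by rewrite big1.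
  rewrite !subr0.
  have : \sum_i budget M i <= #|B|%:R * Delta0 M.
    by rewrite mulr_natl -sumr_const; apply: ler_sum => i _; exact: le_bigmax.
  have b0 : 0 <= #|B|%:R * Delta0 M by rewrite mulr_ge0 ?Delta0_ge0.
  have g0 : 0 <= #|G|%:R * Delta0 M by rewrite mulr_ge0 ?Delta0_ge0.
  rewrite /phase_Delta expr0 divr1; lra.
have [s /scaling_phase_optimal/optimal_total_surplus/andP[_ h] [pick [_ ->]]] := rS k.
have [h1 _] := repair_at_change s pick (phase_Delta_ge0 k).
rewrite phase_DeltaS; lra.
Qed.

Lemma run_step_dist k i j : (0 < #|G|)%N ->
  `|spend (run k.+1) i j - spend (run k) i j| <= 2 * (nn B G)%:R * phase_Delta M k.
Proof.
move=> G0; case: run_alg => _ rS.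
have [s ph [pick [_ ->]]] := rS k.
have D0 := phase_Delta_ge0 k.
have h1 := scaling_phase_change D0 ph i j.
have [_ /(_ i j) h2] := repair_at_change s pick D0.
have /andP[h3 _] := optimal_total_surplus (scaling_phase_optimal ph).
have h4 := run_total_surplus k.
(* As [G] is nonempty, the [Delta / 2] moved by the repair fits into the gap between
   [2 * #|B| + #|G|] and [2 * n]. *)
have h5 : phase_Delta M k <= #|G|%:R * phase_Delta M k.
  by rewrite ler_peMl // ler1n.
rewrite -[X in X - _](subrK (spend s i j)) -addrA.
apply: le_trans (ler_normD _ _) _.
by rewrite /nn natrD; lra.
Qed.

(** The step bound [2 * n * phase_Delta k] equals [4 * n * (phase_Delta k - phase_Delta k.+1)], so
    the bounds telescope. *)
Lemma run_dist k m i j : (0 < #|G|)%N ->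
  `|spend (run (k + m)) i j - spend (run k) i j|
    <= 4 * (nn B G)%:R * (phase_Delta M k - phase_Delta M (k + m)).
Proof.
move=> G0; elim: m => [|m IH]; first by rewrite addn0 !subrr normr0 mulr0.
rewrite addnS phase_DeltaS.
have h := run_step_dist (k + m) i j G0.
rewrite -[X in X - _](subrK (spend (run (k + m)) i j)) -addrA.
apply: le_trans (ler_normD _ _) _.
lra.
Qed.

Lemma run_limit_dist k i j (x : R) : (0 < #|G|)%N ->
  ((fun k => spend (run k) i j) @ \oo --> x)%classic ->
  `|x - spend (run k) i j| <= 4 * (nn B G)%:R * phase_Delta M k.
Proof.
move=> G0 cvx.
have cvs : ((fun m => `|spend (run (m + k)%N) i j - spend (run k) i j|) @ \oo
           --> `|x - spend (run k) i j|)%classic.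
  apply: cvg_norm; apply: cvgB; last exact: cvg_cst.
  by rewrite (cvg_shiftn k (fun k => spend (run k) i j)).
apply: (cvgr_to_le cvs).
apply: nearW => m /=; rewrite addnC; apply: le_trans (run_dist _ _ _ _ _) _ => //.
have := phase_Delta_ge0 (k + m) => h.
by rewrite ler_wpM2l ?mulr_ge0 // lerBlDr lerDl.
Qed.

End Convergence.

(** * Connected components of bipartite graphs and cuts of forests *)

Section Components.
Variables (B G : finType).
Implicit Types (H : {set B * G}).
Local Notation node := (B + G)%type.

Lemma adj_sym H : symmetric (adj H).
Proof. by move=> [i|j] [i'|j']. Qed.

Lemma component_sym H u v : (u \in component H v) = (v \in component H u).
Proof. by rewrite !inE (sym_connect_sym (@adj_sym H)). Qed.

Lemma component_trans H u v w :
  v \in component H u -> w \in component H v -> w \in component H u.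
Proof. by rewrite !inE; exact: connect_trans. Qed.

Lemma component_refl H v : v \in component H v.
Proof. by rewrite inE. Qed.

Lemma component_edge H v i j : (i, j) \in H ->
  (inl i \in component H v) = (inr j \in component H v).
Proof.
move=> ij; apply/idP/idP => /component_trans; apply;
  by rewrite inE; exact: connect1.
Qed.

Lemma componentS H H' v : H \subset H' -> component H v \subset component H' v.
Proof.
move=> /fintype.subsetP sH; apply/fintype.subsetP => w; rewrite !inE.
by apply: connect_sub => -[i|j] [i'|j'] //= h; apply: connect1; exact: sH.
Qed.

Lemma component_has_edge H i v : v \in component H (inl i) -> v != inl i ->
  exists j, (i, j) \in H.
Proof.
rewrite inE => /connectP[[|[i'|j] w] /=]; first by move=> _ ->; rewrite eqxx.
  by [].
by move=> /andP[ij _] _ _; exists j.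
Qed.

Lemma cycle_freeS H H' : H \subset H' -> cycle_free H' -> cycle_free H.
Proof.
move=> /fintype.subsetP sH cf c /andP[cc uc]; apply: cf; rewrite /ucycle uc andbT.
by apply: sub_cycle cc => -[i|j] [i'|j'] //=; exact: sH.
Qed.

(** A simple path from [i] to [j] avoiding the edge would close up with it to a cycle.
    Cycle-freeness leaves only closed walks of size 2, and then the path is the deleted edge
    itself. *)
Lemma cycle_free_cut H i j : cycle_free H -> (i, j) \in H ->
  inr j \notin component (H :\ (i, j)) (inl i).
Proof.
move=> cf ij; apply/negP; rewrite inE => /connectP[w0 pw0 lw0].
case: (shortenP pw0) lw0 => w pw uw _ lw.
have sub : subrel (adj (H :\ (i, j))) (adj H).
  by move=> [i'|j'] [i''|j''] //=; rewrite in_setD1 => /andP[].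
have /cf /= : ucycle (adj H) (inl i :: w : seq node).
  by rewrite /ucycle uw andbT /= rcons_path (sub_path sub) // -lw.
case: w pw {uw} lw => [|v [|? ?]] //= /andP[/= vi _] vj _.
by move: vi; rewrite -vj /= in_setD1 eqxx.
Qed.

End Components.

(** * Integrality of price ratios *)

Section Equilibrium.
Variables (R : realType) (B G : finType) (M : auction R B G).
Variables (Mint : integral_data M) (Mpert : perturbed M).
Local Notation e := (budget M).
Local Notation U := (util M).
Local Notation node := (B + G)%type.

Lemma util_le_Umax i j : 0 < U i j -> U i j <= Umax M.
Proof.
move=> Uij; rewrite /Umax.
exact: (le_bigmax_cond 0 (j := (i, j)) (P := fun ij => 0 < U ij.1 ij.2)
  (fun ij => U ij.1 ij.2)).
Qed.

Lemma int_ge1 (x : R) : x \is a Num.int -> 0 < x -> 1 <= x.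
Proof.
by move=> xi x0; rewrite -(gtr0_norm x0) norm_intr_ge1 // gt_eqF.
Qed.

Lemma Umax_ge1 i j : 0 < U i j -> 1 <= Umax M.
Proof.
move=> Uij; apply: le_trans (util_le_Umax Uij).
by apply: int_ge1 => //; case: Mint.
Qed.

(* The tree grows from [j0] by attaching a buyer [i] at a good [j] already reached,
   together with all goods adjacent to [i]; [Q] and the old [a k] are then
   multiplied by [U i j], and the new goods get [a j * U i k]. *)
Lemma price_ratios_grow (H : {set B * G}) (p : G -> R) j0 n :
  (forall j, 0 < p j) -> (forall i j, (i, j) \in H -> 0 < U i j) ->
  (forall i j k, (i, j) \in H -> (i, k) \in H -> U i j / p j = U i k / p k) ->
  exists (T : {set B}) (S : {set G}) (Q : R) (a : G -> R),
  [/\ j0 \in S,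
      (forall i j, i \in T -> (i, j) \in H -> j \in S),
      (n <= #|T|)%N \/ (forall i j, (i, j) \in H -> j \in S -> i \in T),
      [/\ Q \is a Num.int, 0 < Q & Q <= Umax M ^+ #|T|] &
      forall k, k \in S ->
        [/\ a k \is a Num.int, 0 < a k, a k <= Umax M ^+ #|T| &
            Q * p k = a k * p j0]].
Proof.
move=> p0 U0 rate; elim: n => [|n [T [S [Q [a [Sj0 TS nT [Qi Q0 QU] aP]]]]]].
  exists finset.set0, [set j0]%SET, 1, (fun=> 1); split; rewrite ?inE //.
  - by move=> i j; rewrite finset.in_set0.
  - by left.
  - by split; rewrite ?cards0 ?expr0 ?rpred1.
  - by move=> k; rewrite inE => /eqP ->; rewrite cards0 expr0 rpred1 ltr01.
case: nT => [nT|cl]; last by exists T, S, Q, a; split=> //; right.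
case: (pickP (fun ij => [&& ij \in H, ij.2 \in S & ij.1 \notin T])) =>
    [[i j] /and3P[/= ij Sj nTi]|cl]; last first.
  exists T, S, Q, a; split=> //; right => i j ij Sj.
  by have /= := cl (i, j); rewrite ij Sj /= => /negbFE.
have Uij := U0 _ _ ij.
have [ai aj0 aU aE] := aP _ Sj.
have Ui i' j' : U i' j' \is a Num.int by case: Mint.
have Um := Umax_ge1 Uij; have Um0 : 0 <= Umax M by exact: le_trans Um.
exists (i |: T)%SET, (S :|: [set k | (i, k) \in H])%SET, (Q * U i j),
  (fun k => if k \in S then a k * U i j else a j * U i k).
rewrite cardsU1 nTi add1n exprSr; split.
- by rewrite inE Sj0.
- move=> i' k; rewrite !inE => /predU1P[->|Ti' ik]; first by move=> ->; rewrite orbT.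
  by rewrite (TS _ _ Ti' ik).
- by left; rewrite ltnS.
- split; rewrite ?mulr_gt0 ?rpredM //.
  by rewrite ler_pM ?util_le_Umax // ltW.
- move=> k; rewrite !inE; case: ifP => [Sk _|_ /= ik].
    have [bi b0 bU bE] := aP _ Sk.
    split; rewrite ?mulr_gt0 ?rpredM //; last by rewrite mulrAC bE mulrAC.
    by rewrite ler_pM ?util_le_Umax // ltW.
  have Uik := U0 _ _ ik.
  split; rewrite ?mulr_gt0 ?rpredM //.
    by rewrite ler_pM ?util_le_Umax // ltW.
  have pj : p k * U i j = p j * U i k.
    have := rate _ _ _ ij ik => /eqP; rewrite eqr_div ?(gt_eqF (p0 _)) // => /eqP.
    by rewrite mulrC => ->; rewrite mulrC.
  by rewrite -mulrA [U i j * _]mulrC pj mulrA aE mulrAC.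
Qed.

Lemma price_ratios (H : {set B * G}) (p : G -> R) j0 :
  (forall j, 0 < p j) -> (forall i j, (i, j) \in H -> 0 < U i j) ->
  (forall i j k, (i, j) \in H -> (i, k) \in H -> U i j / p j = U i k / p k) ->
  exists (Q : R) (a : G -> R),
  [/\ Q \is a Num.int, 0 < Q, Q <= Umax M ^+ #|B| &
      forall k, inr k \in component H (inr j0) ->
        [/\ a k \is a Num.int, 0 < a k, a k <= Umax M ^+ #|B| &
            Q * p k = a k * p j0]].
Proof.
move=> p0 U0 rate.
(* More than [#|B|] buyers cannot be collected, so the growth must have ended with a closed tree. *)
have [T [S [Q [a [Sj0 TS nT [Qi Q0 QU] aP]]]]] :=
  price_ratios_grow j0 #|B|.+1 p0 U0 rate.
have Um : Umax M ^+ #|T| <= Umax M ^+ #|B|.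
  have [i Uij] := good_valued_by_some M j0.
  by rewrite ler_weXn2l ?max_card ?(Umax_ge1 Uij).
case: nT => [|cl]; first by rewrite ltnNge max_card.
exists Q, a; split=> // [|k jk]; first exact: le_trans Um.
suff /aP[? ? /le_trans/(_ Um)] : k \in S by [].
(* The tree is closed under adjacency and contains [j0], hence it covers the component of [j0]. *)
pose A (v : node) := match v with inl i => i \in T | inr j => j \in S end.
have /closed_connect clA : fingraph.closed (adj H) A.
  by move=> [i|j] [i'|j'] //= h; apply/idP/idP; rewrite /A !unfold_in /=;
    (exact: TS h || exact: (fun x => TS _ _ x h) || exact: cl h).
by move: jk; rewrite inE => /clA; rewrite -[inr j0 \in A]/(j0 \in S) Sj0 => /esym.
Qed.

(** * Flow balance on the support of an equilibrium *)

Variables (s : state R B G) (s_eq : arctic_equilibrium M s).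
Local Notation p := (price s).
Local Notation H := (spend_support s).

Lemma support_sub : H \subset equality_graph M p.
Proof.
case: s_eq => _ [_ _ xE _].
by apply/fintype.subsetP => -[i j]; rewrite inE; exact: xE.
Qed.

Lemma spend_off_support i j : (i, j) \notin H -> spend s i j = 0.
Proof.
case: s_eq => -[_ x0 _] _.
by rewrite inE -leNgt => h; apply/le_anti; rewrite h x0.
Qed.

Lemma support_rate i j : (i, j) \in H -> U i j / p j = alpha M p i.
Proof. by move=> /(fintype.subsetP support_sub); rewrite inE => /eqP. Qed.

Lemma support_util i j : (i, j) \in H -> 0 < U i j.
Proof.
move=> /support_rate Ea; case: s_eq => -[p0 _ _] _.
have [k Uik] := buyer_values_some M i.
have : 0 < alpha M p i.
  by apply: lt_le_trans (le_bigmax _ (fun j => U i j / p j) k); rewrite divr_gt0.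
by rewrite -Ea pmulr_lgt0 // invr_gt0.
Qed.

(** A positive refund forces [alpha <= 1], a positive spending forces [alpha >= 1]. *)
Lemma refund_alpha i j : 0 < refund s i -> (i, j) \in H -> alpha M p i = 1.
Proof.
move=> ri; rewrite inE /= => xij; case: s_eq => _ [_ _ _ /(_ i)[r1 _ a1]].
apply/le_anti; rewrite r1 //= leNgt; apply/negP => /a1 /(_ j).
by move/eqP; rewrite gt_eqF.
Qed.

(** Buyers spend what is not refunded and goods receive their price, so the left side is the net
    flow of money out of [C]. *)
Lemma cut_balance (C : {set node}) :
  \sum_(i | inl i \in C) (e i - refund s i) - \sum_(j | inr j \in C) p j =
  \sum_i \sum_j spend s i j * ((inl i \in C)%:R - (inr j \in C)%:R).
Proof.
case: s_eq => _ [cE bE _ _].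
rewrite (eq_bigr (fun i => \sum_j spend s i j)) => [|i _]; last first.
  by apply/eqP; rewrite -subr_eq0; apply/eqP; exact: cE.
rewrite [X in _ - X](eq_bigr (fun j => \sum_i spend s i j)) => [|j _]; last first.
  by apply/eqP; rewrite eq_sym -subr_eq0 addrC; apply/eqP; exact: bE.
rewrite big_mkcond [X in _ - X]big_mkcond /=.
under eq_bigr => i _ do rewrite -mulrb -sumrMnl.
under [X in _ - X]eq_bigr => j _ do rewrite -mulrb -sumrMnl.
rewrite [X in _ - X]exchange_big -sumrB; apply: eq_bigr => i _ /=.
by rewrite -sumrB; apply: eq_bigr => j _; rewrite mulrBr !mulr_natr.
Qed.

Lemma component_balance v :
  \sum_(i | inl i \in component H v) (e i - refund s i) =
  \sum_(j | inr j \in component H v) p j.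
Proof.
apply/eqP; rewrite -subr_eq0 cut_balance big1 // => i _; rewrite big1 // => j _.
have [ij|/spend_off_support ->] := boolP ((i, j) \in H); last by rewrite mul0r.
by rewrite (component_edge _ ij) subrr mulr0.
Qed.

(** Once the edge is deleted, [C] is closed under all other support edges, so only this edge can
    cross the cut. *)
Lemma edge_cut_balance i j (v : node) : (i, j) \in H ->
  let C := component (H :\ (i, j))%SET v in
  \sum_(i | inl i \in C) (e i - refund s i) - \sum_(j | inr j \in C) p j =
  spend s i j * ((inl i \in C)%:R - (inr j \in C)%:R).
Proof.
move=> ij C; rewrite cut_balance (bigD1 i) //= (bigD1 j) //=.
have off i' j' : (i', j') != (i, j) ->
    spend s i' j' * ((inl i' \in C)%:R - (inr j' \in C)%:R) = 0.
  move=> ne; have [h|/spend_off_support ->] := boolP ((i', j') \in H);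
    last by rewrite mul0r.
  by rewrite (@component_edge _ _ _ _ i' j') ?subrr ?mulr0 // in_setD1 ne.
rewrite big1 => [|j' nj]; last by rewrite off // xpair_eqE eqxx.
rewrite big1 ?addr0 // => i' ni; rewrite big1 // => j' _.
by rewrite off // xpair_eqE negb_and ni.
Qed.

(** Being connected, both buyers have a support edge, so both have [alpha = 1], against the
    perturbation assumption. *)
Lemma refund_unique i i' : i' != i -> inl i' \in component H (inl i) ->
  0 < refund s i -> 0 < refund s i' -> False.
Proof.
move=> ne ii' ri ri'; case: s_eq => -[p0 _ _] _; have [_ un] := Mpert p0.
have [j ij] := component_has_edge ii' ne.
have [j' ij'] : exists j', (i', j') \in H.
  apply: (@component_has_edge _ _ _ _ (inl i)); first by rewrite component_sym.
  by rewrite eq_sym.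
move: ne; rewrite (un i i' _ (refund_alpha ri ij) (refund_alpha ri' ij')) ?eqxx //.
exact: fintype.subsetP (componentS _ support_sub) _ ii'.
Qed.

Lemma support_cycle_free : cycle_free H.
Proof.
case: s_eq => -[p0 _ _] _; have [cf _] := Mpert p0.
exact: cycle_freeS support_sub cf.
Qed.

Lemma refund_eq0 i : ~~ (0 < refund s i) -> refund s i = 0.
Proof.
case: s_eq => -[_ _ r0] _.
by rewrite -leNgt => h; apply/le_anti; rewrite h r0.
Qed.

Lemma sum_budget_eq (C : {set node}) :
  (forall i, inl i \in C -> ~~ (0 < refund s i)) ->
  \sum_(i | inl i \in C) (e i - refund s i) = \sum_(i | inl i \in C) e i.
Proof. by move=> nr; apply: eq_bigr => i /nr/refund_eq0 ->; rewrite subr0. Qed.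

(* At most one side of the cut at the edge (i, j) contains a refunded buyer;
   the spending on the edge is read off the balance of the other side. *)
Lemma spend_sides i j : (i, j) \in H ->
  exists C : {set node}, C \subset component H (inl i) /\
    `|spend s i j| =
      `|\sum_(i | inl i \in C) e i - \sum_(j | inr j \in C) p j|.
Proof.
move=> ij; set H' := (H :\ (i, j))%SET.
have sH : H' \subset H by exact: finset.subD1set.
have nj : inr j \notin component H' (inl i) by exact: cycle_free_cut support_cycle_free _.
have ni : inl i \notin component H' (inr j) by rewrite component_sym.
have ijC : inr j \in component H (inl i) by rewrite -(component_edge _ ij) component_refl.
case: (pickP (fun i0 => (inl i0 \in component H' (inl i)) && (0 < refund s i0))) =>
    [i0 /andP[i0i r0]|nr]; last first.
  exists (component H' (inl i)); split; first exact: componentS.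
  have := edge_cut_balance (inl i) ij; rewrite /= -/H' (negPf nj) component_refl.
  rewrite subr0 mulr1 sum_budget_eq => [->//|i' Ci'].
  by have := nr i'; rewrite Ci' /= => ->.
exists (component H' (inr j)); split.
  apply/fintype.subsetP => u uj; apply: component_trans ijC _.
  exact: fintype.subsetP (componentS _ sH) _ uj.
have := edge_cut_balance (inr j) ij; rewrite /= -/H' (negPf ni) component_refl.
rewrite sub0r mulrN1 sum_budget_eq => [->|i' Ci']; first by rewrite normrN.
apply/negP => r'; have ne : i' != i0.
  apply: contra nj => /eqP ei; apply: component_trans i0i _.
  by rewrite component_sym -ei.
apply: refund_unique ne _ r0 r'.
have i0H : inl i \in component H (inl i0).
  by rewrite component_sym; exact: fintype.subsetP (componentS _ sH) _ i0i.
apply: component_trans i0H (component_trans ijC _).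
exact: fintype.subsetP (componentS _ sH) _ Ci'.
Qed.

(** The ratios [a k / Q] fix the prices of a component up to scale. The scale comes from a refunded
    buyer, at whom some price equals an integral utility, or else from the total budget of the
    component. *)
Lemma component_denominator i j : (i, j) \in H ->
  exists l : R, [/\ l \is a Num.int, 0 < l, l <= DD M &
    forall k, inr k \in component H (inl i) -> l * p k \is a Num.int].
Proof.
move=> ij; case: (s_eq) => -[p0 _ _] _; have [ei Ui] := Mint.
have Um := Umax_ge1 (support_util ij).
have UB : Umax M ^+ #|B| <= Umax M ^+ nn B G by rewrite ler_weXn2l // leq_addr.
(* The factor [n] of [DD] pays for a sum of up to [#|G|] numerators [a k]. *)
have UG : #|G|%:R * Umax M ^+ #|B| <= DD M.
  by rewrite /DD ler_pM ?ler_nat ?leq_addl // exprn_ge0 // (le_trans _ Um).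
have U1 : Umax M ^+ #|B| <= DD M.
  apply: le_trans UG; rewrite ler_peMl ?exprn_ge0 ?(le_trans _ Um) // ler1n.
  by apply/card_gt0P; exists j.
have rate i1 j1 k1 : (i1, j1) \in H -> (i1, k1) \in H ->
    U i1 j1 / p j1 = U i1 k1 / p k1.
  by move=> /support_rate-> /support_rate->.
have ijC : inr j \in component H (inl i) by rewrite -(component_edge _ ij) component_refl.
case: (pickP (fun i0 => (inl i0 \in component H (inl i)) && (0 < refund s i0))) =>
    [i0 /andP[i0i r0]|nr].
  have [j0 ij0] : exists j0, (i0, j0) \in H.
    apply: (@component_has_edge _ _ _ _ (inr j)) => //.
    by apply: component_trans _ ijC; rewrite component_sym.
  have [Q [a [Qi Q0 QU aP]]] := price_ratios j0 p0 support_util rate.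
  exists Q; split=> // [|k Ck]; first exact: le_trans U1.
  have [|ai _ _ ->] := aP k.
    apply: component_trans Ck; rewrite component_sym.
    by rewrite -(component_edge _ ij0).
  rewrite rpredM //.
  have : U i0 j0 / p j0 = 1 by rewrite support_rate // (refund_alpha r0 ij0).
  by move/divr1_eq => <-.
have [Q [a [Qi Q0 QU aP]]] := price_ratios j p0 support_util rate.
have {}aP k (Ck : inr k \in component H (inl i)) :=
  aP k (component_trans (etrans (component_sym _ _ _) ijC) Ck).
(* Summing [Q * p k = a k * p j] over the component gives [Q * (total price) = l * p j]; eliminating
   [p j] cancels [Q], so [l] alone is a denominator. *)
pose l := \sum_(k | inr k \in component H (inl i)) a k.
have li : l \is a Num.int by apply: rpred_sum => k /aP[].
have lp k : inr k \in component H (inl i) ->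
    l * p k = a k * \sum_(i' | inl i' \in component H (inl i)) e i'.
  move=> Ck; have [_ _ _ Ek] := aP k Ck.
  rewrite -sum_budget_eq => [|i' Ci']; last by have := nr i'; rewrite Ci' /= => ->.
  rewrite component_balance; apply: (mulfI (lt0r_neq0 Q0)).
  rewrite mulrCA Ek mulrCA [RHS]mulrCA; congr (_ * _).
  rewrite mulr_sumr mulr_suml; apply: eq_bigr => k' Ck'.
  by have [_ _ _ ->] := aP k' Ck'.
exists l; split=> // [||k Ck].
- rewrite /l (bigD1 j) //= ltr_pwDl ?sumr_ge0 // => [|k /andP[Ck _]].
    by case: (aP j ijC).
  by case: (aP k Ck) => _ /ltW.
- apply: le_trans UG; rewrite mulr_natl -sumr_const /l big_mkcond /=.
  apply: ler_sum => k _; case: ifP => [/aP[]//|_].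
  by rewrite exprn_ge0 // (le_trans _ Um).
- have [? _ _ _] := aP k Ck.
  by rewrite lp // rpredM // rpred_sum.
Qed.

(** Multiplied by the common denominator [l], the spending becomes a nonzero integer up to sign,
    hence at least 1. *)
Lemma support_spend_ge i j : (i, j) \in H -> 1 / DD M <= spend s i j.
Proof.
move=> ij; have [l [li l0 lD lp]] := component_denominator ij.
have xij : 0 < spend s i j by move: (ij); rewrite inE.
have [C [/fintype.subsetP sC]] := spend_sides ij; rewrite gtr0_norm // => xE.
suff h : 1 <= l * spend s i j.
  rewrite ler_pdivrMr ?(lt_le_trans l0) //; apply: le_trans h _.
  by rewrite mulrC ler_wpM2l // ltW.
rewrite xE -(gtr0_norm l0) -normrM; apply: norm_intr_ge1; last first.
  by rewrite -normr_eq0 normrM -xE (gtr0_norm l0) gt_eqF // mulr_gt0.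
by rewrite mulrBr rpredB ?mulr_sumr ?rpred_sum // => [i' _|k /sC/lp//];
  rewrite rpredM //; case: Mint.
Qed.

Lemma support_basic_solution : basic_solution M H s.
Proof.
case: (s_eq) => -[p0 x0 r0] [cE bE _ _]; have [_ un] := Mpert p0.
split; first exact: support_cycle_free.
split=> //.
(* A buyer without support edge forms a component without goods, where no price can match the
   positive budget; there (b) is imposed, with [unit_rate] holding vacuously. *)
pose anchors := [set i | (0 < refund s i) || [forall j, (i, j) \notin H]]%SET.
exists anchors; split.
- by move=> i j k /support_rate -> /support_rate ->.
- move=> v C.
  have isolated i w : inl i \in C -> [forall j, (i, j) \notin H] ->
      w \in C -> w = inl i.
    move=> Ci /forallP ni Cw; apply/eqP; case: eqVneq => // ne.
    have [|j ij] := @component_has_edge _ _ H i w _ ne; last by have := ni j; rewrite ij.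
    by apply: component_trans Cw; rewrite component_sym.
  case: (pickP (fun i => (inl i \in C) && (i \in anchors))) => [i /andP[Ci ai]|na].
    right; exists i.
    have [iso|niso] := boolP [forall j, (i, j) \notin H].
      split=> // [i' Ci'|j ij|i' Ci' _].
      + by have [->] := isolated _ _ Ci iso Ci'; rewrite ai eqxx.
      + by have /forallP/(_ j) := iso; rewrite ij.
      + by have [] := isolated _ _ Ci iso Ci'.
    have ri : 0 < refund s i by move: ai; rewrite inE (negPf niso) orbF.
    have [j] := forallPn niso; rewrite negbK => ij.
    have ai1 := refund_alpha ri ij.
    have uniq_rate i' : inl i' \in C -> alpha M p i' = 1 -> i' = i.
      move=> Ci' a'; apply/esym; apply: un => //.
      apply: (fintype.subsetP (componentS _ support_sub)).
      by apply: component_trans Ci'; rewrite component_sym.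
    (* [i] has an edge, so [C] is no singleton and none of its buyers is isolated; hence [unit_rate]
       at [i'] really means [alpha = 1]. *)
    have edge i' : inl i' \in C -> exists j', (i', j') \in H.
      move=> Ci'; case: (boolP [forall j', (i', j') \notin H]) => [iso'|]; last first.
        by move=> /forallPn[j' /negPn ij']; exists j'.
      by have := isolated _ _ Ci' iso' Ci => -[E]; rewrite E iso' in niso.
    split=> // [i' Ci'|k ik|i' Ci' ur].
    + apply/idP/eqP => [ai'|->//].
      have [j' ij'] := edge _ Ci'; apply: uniq_rate => //.
      move: ai'; rewrite inE => /orP[/refund_alpha/(_ ij')//|/forallP/(_ j')].
      by rewrite ij'.
    + by rewrite support_rate.
    + have [j' ij'] := edge _ Ci'; apply: uniq_rate => //.
      by rewrite -(support_rate ij') ur.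
  (* Without anchors no buyer of [C] is refunded, and the balance of the component is equation
     (a). *)
  left; split=> [i Ci|]; first by have := na i; rewrite Ci /= => ->.
  rewrite -component_balance sum_budget_eq // => i Ci.
  by have := na i; rewrite Ci inE /= => /negbT; rewrite negb_or => /andP[].
- exact: spend_off_support.
- split=> [i|i|j].
  + by have := cE i; rewrite /surplus => ?; lra.
  + by rewrite inE negb_or => /andP[/refund_eq0].
  + by have := bE j; rewrite /excess => ?; lra.
Qed.

End Equilibrium.

Theorem theorem3p1 (R : realType) (B G : finType) (M : auction R B G)
    (Mint : integral_data M) (Mpert : perturbed M)
    (run : nat -> state R B G) (run_alg : scaling_run M run)
    (sstar : state R B G) (sstar_lim : limiting_equilibrium M run sstar)
    (k : nat) (Delta : R) (Delta_k : Delta = phase_Delta M k)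
    (Delta_small : Delta < 1 / (8 * (nn B G)%:R * DD M)) :
  abundant_edges Delta (run k) = spend_support sstar /\
  basic_solution M (abundant_edges Delta (run k)) sstar.
Proof.
have [eqs [_ cx _]] := sstar_lim.
suff -> : abundant_edges Delta (run k) = spend_support sstar.
  by split=> //; exact: support_basic_solution.
apply/setP => -[i j]; rewrite !inE /=.
have G0 : (0 < #|G|)%N by apply/card_gt0P; exists j.
have := run_limit_dist run_alg k G0 (cx i j); rewrite -Delta_k ler_norml => /andP[lo hi].
(* Above the threshold, a drift of at most [4 * n * Delta] cannot bring the spending to 0. *)
apply/idP/idP => [h|h]; first by lra.
have n0 : 0 < (nn B G)%:R :> R by rewrite ltr0n addn_gt0 G0 orbT.
have xD : 1 / DD M <= spend sstar i j.
  by apply: support_spend_ge => //; rewrite inE.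
(* Conversely, a limit above [8 * n * Delta] keeps the current spending above [4 * n * Delta]. *)
have : 8 * (nn B G)%:R * Delta < 1 / DD M.
  by move: Delta_small; rewrite [_ * DD M]mulrC !div1r invfM mulrC ltr_pdivlMl ?mulr_gt0.
lra.
Qed.
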